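(* Let $\{\eta_k\}$ be an $N$-periodic binary sequence such that $$\rho(\bar A_{N-1}\bar A_{N-2}\cdots\bar A_0)=\bar q_A<1,\qquad \rho(\tilde A_{N-1}\tilde A_{N-2}\cdots\tilde A_0)=\tilde q_A<1 .$$ Let $\mu_{x,k}=\mathbb{E}[x_k]$ and $\mu_{e,k}=\mathbb{E}[e_k]$, which satisfy $$\mu_{x,k+1}=\bar A_k\mu_{x,k}-\eta_k BK\mu_{e,k}+\eta_k B u_T,\qquad \mu_{e,k+1}=\tilde A_k\mu_{e,k}.$$ Then, as $k\to\infty$, $\mu_{e,k}\to 0$ and $\mu_{x,k}\to\mu_{x,k}^{\rm s}$ exponentially (i.e., $\|\mu_{e,k}\|$ and $\|\mu_{x,k}-\mu_{x,k}^{\rm s}\|$ tend to $0$ exponentially fast), where $\{\mu_{x,k}^{\rm s}\}$ is the unique $N$-periodic solution of the first recursion with $\mu_{e,k}\equiv 0$, that is, of $\mu_{x,k+1}=\bar A_k\mu_{x,k}+\eta_k Bu_T$. Furthermore, if $u_T=0$ then $\mu_{x,k}^{\rm s}=0$ for all $k$.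
   Context: Let $A\in\mathbb{R}^{n\times n}$, $B\in\mathbb{R}^{n\times m}$, $C\in\mathbb{R}^{p\times n}$, $K\in\mathbb{R}^{m\times n}$, $L\in\mathbb{R}^{n\times p}$, $u_T\in\mathbb{R}^m$ (a constant feedforward input). For an $N$-periodic binary sequence $\{\eta_k\}_{k\ge0}$ ($\eta_k\in\{0,1\}$, $\eta_{k+N}=\eta_k$), put $\bar A_k=A+\eta_kBK$ and $\tilde A_k=A+(1-\eta_k)LC$. The state $x_k$ and the state estimation error $e_k$ evolve, for $k\in\mathbb{Z}_{\ge 0}$, according to $$x_{k+1}=\bar A_kx_k-\eta_kBKe_k+\eta_kBu_T+w_k,\qquad e_{k+1}=\tilde A_ke_k+w_k+(1-\eta_k)L\nu_k,$$ where $\{w_k\}$ and $\{\nu_k\}$ are zero-mean, i.i.d. and mutually independent random sequences with finite covariances $\Sigma_w=\mathbb{E}[w_kw_k^{\rm T}]$, $\Sigma_\nu=\mathbb{E}[\nu_k\nu_k^{\rm T}]$. The initial $x_0,e_0$ have finite means. $\rho(\cdot)$ denotes the spectral radius. *)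

(* Defs.v *)
From HB Require Import structures.
From mathcomp Require Import all_boot all_order all_algebra.
From mathcomp Require Import finmap.
From mathcomp Require Import all_classical all_reals all_analysis.
From mathcomp Require Import complex.

Set Implicit Arguments.
Unset Strict Implicit.
Unset Printing Implicit Defensive.

Import Order.TTheory GRing.Theory Num.Theory.
Import numFieldNormedType.Exports.

Local Open Scope classical_set_scope.
Local Open Scope ring_scope.

Section linear_algebra.
Context {R : realType}.

(* Maximum modulus of the complex eigenvalues; the supremum is over a finite
   set, nonempty unless n = 0 (in which case the value is sup set0 = 0). *)
Definition spectral_radius n (M : 'M[R]_n) : R :=
  sup [set ComplexField.Normc.normc l
      | l in [set l : complex R | eigenvalue (map_mx (real_complex R) M) l]].

(* M (N-1) *m ... *m M 1 *m M 0 *)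
Definition period_product n (M : nat -> 'M[R]_n) (N : nat) : 'M[R]_n :=
  \big[mulmx/1%:M]_(i < N) M (rev_ord i).

Definition euclidean_norm n (v : 'cV[R]_n) : R :=
  Num.sqrt (\sum_(i < n) v i 0 ^+ 2).

Definition vanishes_exponentially n (v : nat -> 'cV[R]_n) : Prop :=
  exists c r : R, [/\ 0 <= c, 0 <= r, r < 1 &
    forall k, euclidean_norm (v k) <= c * r ^+ k].

Definition periodic_seq (U : Type) (N : nat) (u : nat -> U) : Prop :=
  forall k, u (k + N)%N = u k.

End linear_algebra.

Section random_vectors.
Context {d : measure_display} {T : measurableType d} {R : realType}.
Variable P : probability T R.

(* R^n with its Borel sigma-algebra *)
Definition borel_cV n := g_sigma_algebraType (@open 'cV[R]_n).

Definition random_vector n (X : T -> 'cV[R]_n) : Prop :=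
  measurable_fun [set: T] (X : T -> borel_cV n).

Definition sigma_of n (X : T -> 'cV[R]_n) : set (set T) :=
  [set X @^-1` B | B in (measurable : set (set (borel_cV n)))].

Definition same_distribution n (X Y : T -> 'cV[R]_n) : Prop :=
  forall B : set (borel_cV n), measurable B ->
    P (X @^-1` B) = P (Y @^-1` B).

Definition mutually_independent (I : choiceType) (F : I -> set (set T)) : Prop :=
  forall (J : {fset I}) (E : I -> set T), (forall i, i \in J -> F i (E i)) ->
    P (\bigcap_(i in [set` J]) E i) = (\prod_(i <- J) P (E i))%E.

(* Each of the two sequences is i.i.d. and they are independent of each other,
   i.e. the combined family of all w k and v k is mutually independent. *)
Definition iid_mutually_independent n p
    (w : nat -> T -> 'cV[R]_n) (v : nat -> T -> 'cV[R]_p) : Prop :=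
  [/\ (forall k, random_vector (w k)), (forall k, random_vector (v k)),
      (forall k, same_distribution (w k) (w 0%N)),
      (forall k, same_distribution (v k) (v 0%N)) &
      mutually_independent (fun i : nat + nat =>
        match i with inl k => sigma_of (w k) | inr k => sigma_of (v k) end)].

Definition integrable_vector n (X : T -> 'cV[R]_n) : Prop :=
  forall i, P.-integrable [set: T] (fun t => (X t i 0)%:E).

(* Meaningful for integrable vectors only: fine sends infinities to 0. *)
Definition mean n (X : T -> 'cV[R]_n) : 'cV[R]_n :=
  \col_i fine 'E_P[(fun t => X t i 0)%R]%E.

(* S = E[X X^T], all entries being finite *)
Definition has_second_moment n (X : T -> 'cV[R]_n) (S : 'M[R]_n) : Prop :=
  forall i j,
    P.-integrable [set: T] (fun t => ((X t *m (X t)^T) i j)%:E) /\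
    'E_P[(fun t => (X t *m (X t)^T) i j)%R]%E = (S i j)%:E.

End random_vectors.

Section closed_loop.
Context {R : realType} {n m p : nat}.

Definition Abar (A : 'M[R]_n) (B : 'M[R]_(n, m)) (K : 'M[R]_(m, n))
    (eta : nat -> bool) (k : nat) : 'M[R]_n :=
  A + (eta k)%:R *: (B *m K).

Definition Atilde (A : 'M[R]_n) (L : 'M[R]_(n, p)) (C : 'M[R]_(p, n))
    (eta : nat -> bool) (k : nat) : 'M[R]_n :=
  A + (1 - (eta k)%:R) *: (L *m C).

Definition periodic_mean_solution (A : 'M[R]_n) (B : 'M[R]_(n, m))
    (K : 'M[R]_(m, n)) (uT : 'cV[R]_m) (eta : nat -> bool) (N : nat)
    (s : nat -> 'cV[R]_n) : Prop :=
  periodic_seq N s /\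
  forall k, s k.+1 = Abar A B K eta k *m s k + (eta k)%:R *: (B *m uT).

End closed_loop.

(* Main.v *)
Require Import Defs.
From mathcomp Require Import all_boot all_order all_algebra.
From mathcomp Require Import all_classical all_reals all_analysis.
From mathcomp Require Import complex ring lra.

(** Taking expectations in the two recursions kills the centred noises, because
    the expectation is linear on integrable vectors ([mean_add], [mean_mulmx]).
    What remains is deterministic: two linear recursions with [N]-periodic
    coefficients, the first one driven by the solution of the second.

    Everything then rests on one stability result, [stable_recurrence]: if
    [y (k+1) = M y k + g k], the spectral radius of [M] is less than 1 and [g]
    vanishes exponentially, then so does [y].  The Jordan form is avoided as
    follows.  Over the complex numbers the characteristic polynomial of [M] is
    [prod_i ('X - l_i)] with [|l_i| < 1]; for a polynomial [Q] put
    [z_Q k = Q(M) y k].  Then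
    [z_Q (k+1) = l z_Q k + z_(Q * ('X - l)) k + Q(M) g k], so each entry of [z_Q]
    obeys a scalar contraction driven by the corresponding entry of
    [z_(Q * ('X - l))], up to a vanishing term.  By Cayley-Hamilton [z_Q = 0] for
    [Q] the characteristic polynomial; peeling off its linear factors one at a
    time brings the decay down to [Q = 1], that is, to [y].

    For periodic coefficients, sampling a solution once per period gives a
    recursion of that form whose matrix is the product over the period; within a
    period the solution is a fixed linear image of its sample plus a vanishing
    term, and the [N] interleaved subsequences recombine into an exponentially
    vanishing sequence ([stable_periodic]).

    This gives the decay of the mean of [e], and it makes every vector fixed by
    the period product vanish, so that [1 - period product] is invertible; solving
    [s N = s 0] for the initial value yields the periodic solution
    ([periodic_solution]).  Its uniqueness holds because the difference of two
    periodic solutions is periodic and vanishes exponentially.  Finally the mean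
    of [x] minus the periodic solution solves the recursion driven by the mean
    of [e] alone. *)

Set Implicit Arguments.
Unset Strict Implicit.
Unset Printing Implicit Defensive.

Import Order.TTheory GRing.Theory Num.Theory.
Local Open Scope ring_scope.

(** * Geometric decay of real sequences *)

Section geometric_decay.
Context {R : realType}.
Implicit Types a b : nat -> R.

(** Only an upper bound is required, since the sequences of interest are norms;
    this makes the class closed under passing to a smaller sequence. *)
Definition decays a : Prop :=
  exists c r : R, [/\ 0 <= c, 0 <= r, r < 1 & forall k, a k <= c * r ^+ k].

Lemma decays_le a b : (forall k, a k <= b k) -> decays b -> decays a.
Proof.
move=> ab [c [r [c0 r0 r1 H]]]; exists c, r; split=> // k.
exact: le_trans (ab k) (H k).
Qed.

Lemma decays0 : decays (fun=> 0).
Proof. by exists 0, 0; split=> // k; rewrite mul0r. Qed.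

Lemma decaysD a b : decays a -> decays b -> decays (fun k => a k + b k).
Proof.
move=> [c [r [c0 r0 r1 Ha]]] [c' [r' [c'0 r'0 r'1 Hb]]].
exists (c + c'), (Num.max r r'); split.
- exact: addr_ge0.
- by rewrite le_max r0.
- by rewrite gt_max r1.
move=> k; rewrite mulrDl lerD//.
- apply: le_trans (Ha k) _; rewrite ler_wpM2l// lerXn2r ?nnegrE//.
  + by rewrite le_max r0.
  + by rewrite le_max lexx.
- apply: le_trans (Hb k) _; rewrite ler_wpM2l// lerXn2r ?nnegrE//.
  + by rewrite le_max r0.
  + by rewrite le_max lexx orbT.
Qed.

Lemma decaysZ (l : R) a : 0 <= l -> decays a -> decays (fun k => l * a k).
Proof.
move=> l0 [c [r [c0 r0 r1 H]]]; exists (l * c), r; split=> //.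
  exact: mulr_ge0.
by move=> k; rewrite -mulrA ler_wpM2l.
Qed.

Lemma decays_sum n (a : 'I_n -> nat -> R) :
  (forall i, decays (a i)) -> decays (fun k => \sum_(i < n) a i k).
Proof.
move=> H; elim: n a H => [|n IH] a H.
  by apply: decays_le decays0 => k; rewrite big_ord0.
apply: (@decays_le _ (fun k => \sum_(i < n) a (widen_ord (leqnSn n) i) k
                               + a ord_max k)).
  by move=> k; rewrite big_ord_recr.
by apply: decaysD => //; apply: IH.
Qed.

(** A contraction by [q] driven by a term [c * r ^+ k] decays at any rate [s]
    beyond both [q] and [r]; taking [s] strictly beyond [q] avoids the factor [k]
    that resonance produces when [q = r]. *)
Lemma decays_rec (q : R) a b : 0 <= q -> q < 1 ->
  (forall k, a k.+1 <= q * a k + b k) -> decays b -> decays a.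
Proof.
move=> q0 q1 rec [c [r [c0 r0 r1 Hb]]].
pose s := (1 + Num.max q r) / 2.
have qm : q <= Num.max q r by rewrite le_max lexx.
have rm : r <= Num.max q r by rewrite le_max lexx orbT.
have m1 : Num.max q r < 1 by rewrite gt_max q1.
have qs : q < s by rewrite /s; lra.
have rs : r <= s by rewrite /s; lra.
have s1 : s < 1 by rewrite /s; lra.
have s0 : 0 <= s by lra.
have D0 : 0 < s - q by lra.
have cD : 0 <= c / (s - q) by rewrite divr_ge0// ltW.
(* The second summand t solves q * t + c = s * t; the first covers k = 0. *)
exists (`|a 0%N| + c / (s - q)), s; split=> //.
  exact: addr_ge0.
elim=> [|k IH].
  by rewrite expr0 mulr1 (le_trans (ler_norm _))// lerDl.
apply: le_trans (rec k) _.
set M := _ + _ in IH *.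
have cM : c <= M * (s - q).
  by rewrite /M mulrDl divfK ?gt_eqF// lerDr mulr_ge0// ltW.
have H1 : b k <= c * s ^+ k.
  by apply: le_trans (Hb k) _; rewrite ler_wpM2l// lerXn2r.
have H2 : c * s ^+ k <= M * (s - q) * s ^+ k by rewrite ler_wpM2r// exprn_ge0.
have H3 : q * a k <= q * (M * s ^+ k) by rewrite ler_wpM2l.
rewrite exprS; move: (s ^+ k) IH H1 H2 H3 => t *; nra.
Qed.

Lemma decays_subseq N j a : (0 < N)%N -> decays a ->
  decays (fun q => a (q * N + j)%N).
Proof.
move=> N0 [c [r [c0 r0 r1 H]]]; exists c, r; split=> // q.
apply: le_trans (H _) _; rewrite ler_wpM2l// ler_wiXn2l ?(ltW r1)//.
by rewrite (leq_trans (leq_pmulr q N0))// leq_addr.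
Qed.

(** The sum of the positive parts dominates each sequence, so one pair of
    constants serves the whole family. *)
Lemma decays_uniform n (a : 'I_n -> nat -> R) :
  (forall i, decays (a i)) ->
  exists c r : R, [/\ 0 <= c, 0 <= r, r < 1 & forall i k, a i k <= c * r ^+ k].
Proof.
move=> H.
have /decays_sum [c [r [c0 r0 r1 Hs]]] :
  forall i, decays (fun k => `|Num.max 0 (a i k)|).
  move=> i; have [c [r [c0 r0 r1 Hi]]] := H i; exists c, r; split=> // k.
  rewrite ger0_norm ?le_max ?lexx// ge_max Hi andbT.
  by rewrite mulr_ge0 ?exprn_ge0.
exists c, r; split=> // i k; apply: le_trans (Hs k).
rewrite (bigD1 i)//= ler_wpDr ?sumr_ge0//.
by apply: le_trans (ler_norm _); rewrite le_max lexx orbT.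
Qed.

(** By Bernoulli's inequality [s = 1 - (1 - r) / (2 N)] works; it replaces the
    [N]-th root of [r], which would be 0 for [r = 0]. *)
Lemma exists_root_majorant N (r : R) : (0 < N)%N -> 0 <= r -> r < 1 ->
  exists s : R, [/\ 0 < s, s < 1 & r <= s ^+ N].
Proof.
move=> N0 r0 r1; have NR0 : 0 < N%:R :> R by rewrite ltr0n.
pose d : R := (1 - r) / (2 * N%:R).
have d0 : 0 < d by rewrite divr_gt0 ?mulr_gt0 ?subr_gt0.
have Nd : N%:R * d = (1 - r) / 2 by rewrite /d; field; rewrite gt_eqF.
have d2 : d <= (1 - r) / 2.
  by rewrite -Nd ler_peMl ?ler1n// ltW.
exists (1 - d); split; [lra|lra|].
suff : 1 - N%:R * d <= (1 - d) ^+ N by rewrite Nd; lra.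
elim: (N) => [|M IH]; first by rewrite expr0 mul0r subr0.
rewrite exprS -natr1.
have := ler_wpM2l (_ : 0 <= 1 - d) IH => /(_ ltac:(lra)) H.
apply: le_trans H.
have : 0 <= M%:R * d ^+ 2 by rewrite mulr_ge0 ?sqr_ge0.
by rewrite expr2; nra.
Qed.

(** A bound [c * r ^+ q] on the [q]-th block of length [N] becomes a bound at
    rate [s] with [r <= s ^+ N]; the factor [1 / s ^+ N] pays for the position
    inside the block. *)
Lemma decays_merge N a : (0 < N)%N ->
  (forall j, (j < N)%N -> decays (fun q => a (q * N + j)%N)) -> decays a.
Proof.
move=> N0 H.
have /decays_uniform [c [r [c0 r0 r1 Hs]]] :
  forall j : 'I_N, decays (fun q => a (q * N + j)%N) by move=> j; apply: H.
have [s [s0 s1 rs]] := exists_root_majorant N0 r0 r1.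
exists (c / s ^+ N), s; split=> //.
- by rewrite divr_ge0 ?exprn_ge0// ltW.
- exact: ltW.
move=> k; rewrite {1}(divn_eq k N).
apply: le_trans (Hs (Ordinal (ltn_pmod k N0)) _) _.
rewrite -mulrA ler_wpM2l// mulrC ler_pdivlMr ?exprn_gt0//.
apply: (@le_trans _ _ (s ^+ (k %/ N * N) * s ^+ N)).
  rewrite ler_wpM2r ?exprn_ge0 ?(ltW s0)// mulnC exprM.
  by rewrite lerXn2r ?nnegrE ?exprn_ge0// (ltW s0).
rewrite -exprD ler_wiXn2l ?(ltW s0) ?(ltW s1)// {1}(divn_eq k N) leq_add2l.
by rewrite ltnW// ltn_pmod.
Qed.

End geometric_decay.

(** * Exponentially vanishing vector sequences *)

Section vector_decay.
Context {R : realType}.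

Lemma vanishes_exponentiallyP n (v : nat -> 'cV[R]_n) :
  vanishes_exponentially v <-> forall i, decays (fun k => `|v k i 0|).
Proof.
split=> [H i|H].
  apply: decays_le H => k; rewrite /euclidean_norm -sqrtr_sqr ler_wsqrtr//.
  by rewrite (bigD1 i)//= lerDl sumr_ge0// => j _; rewrite sqr_ge0.
apply: decays_le (decays_sum H) => k.
rewrite /euclidean_norm -[leRHS]ger0_norm ?sumr_ge0// -sqrtr_sqr ler_wsqrtr//.
have [//] : \sum_i v k i 0 ^+ 2 <= (\sum_i `|v k i 0|) ^+ 2
            /\ 0 <= \sum_i `|v k i 0|.
elim/big_ind2: _ => [|a b a' b' [ab b0] [ab' b0']|i _].
- by rewrite expr0n.
- by split; [nra|exact: addr_ge0].
- by rewrite real_normK ?num_real.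
Qed.

Lemma vanishes0 n : vanishes_exponentially (fun=> 0 : 'cV[R]_n).
Proof.
apply/vanishes_exponentiallyP => i; apply: decays_le decays0 => k.
by rewrite mxE normr0.
Qed.

Lemma vanishesD n (u v : nat -> 'cV[R]_n) :
  vanishes_exponentially u -> vanishes_exponentially v ->
  vanishes_exponentially (fun k => u k + v k).
Proof.
move=> /vanishes_exponentiallyP Hu /vanishes_exponentiallyP Hv.
apply/vanishes_exponentiallyP => i; apply: decays_le (decaysD (Hu i) (Hv i)).
by move=> k; rewrite mxE ler_normD.
Qed.

Lemma vanishes_mulmx n m (M : 'M[R]_(m, n)) (v : nat -> 'cV[R]_n) :
  vanishes_exponentially v -> vanishes_exponentially (fun k => M *m v k).
Proof.
move=> /vanishes_exponentiallyP H; apply/vanishes_exponentiallyP => i.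
have H' l : decays (fun k => `|M i l| * `|v k l 0|) by exact: decaysZ.
apply: decays_le (decays_sum H') => k; rewrite mxE.
by apply: le_trans (ler_norm_sum _ _ _) _; under eq_bigr do rewrite normrM.
Qed.

Lemma vanishes_indicator n (b : nat -> bool) (v : nat -> 'cV[R]_n) :
  vanishes_exponentially v -> vanishes_exponentially (fun k => (b k)%:R *: v k).
Proof.
move=> /vanishes_exponentiallyP H; apply/vanishes_exponentiallyP => i.
apply: decays_le (H i) => k; rewrite mxE.
by case: (b k); rewrite ?mul1r ?mul0r ?normr0.
Qed.

Lemma vanishes_cst n (v : 'cV[R]_n) : vanishes_exponentially (fun=> v) -> v = 0.
Proof.
move=> /vanishes_exponentiallyP H; apply/colP => i; rewrite mxE.
have [c [r [c0 r0 r1 Hi]]] := H i.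
apply/eqP; rewrite -normr_eq0; apply/negPn/negP => v0.
have {}v0 : 0 < `|v i 0| by rewrite lt_neqAle eq_sym v0 normr_ge0.
have c_gt0 : 0 < c by have := Hi 0%N; rewrite expr0 mulr1; apply: lt_le_trans.
have r1' : `|r| < 1 by rewrite ger0_norm.
have := cvg_expr r1' => /cvgrPdist_lt/(_ (`|v i 0| / c) (divr_gt0 v0 c_gt0)).
case=> k _ /(_ k (leqnn k)).
rewrite sub0r normrN ger0_norm ?exprn_ge0// ltr_pdivlMr// mulrC.
by rewrite ltNge Hi.
Qed.

End vector_decay.

(** * Linear recurrences with spectral radius below one *)

Section spectral.
Context {R : realType}.
Local Notation normc := ComplexField.Normc.normc.
Local Notation toC := (real_complex R).

Lemma normc_ge0 (z : R[i]) : 0 <= normc z.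
Proof. by case: z => a b; apply: sqrtr_ge0. Qed.

Lemma normc_real (a : R) : normc (toC a) = `|a|.
Proof. by rewrite /= expr0n/= addr0 sqrtr_sqr. Qed.

Lemma normc_sum n (F : 'I_n -> R[i]) :
  normc (\sum_i F i) <= \sum_i normc (F i).
Proof.
elim/big_ind2: _ => [|z a w b za wb|//].
  by rewrite ComplexField.Normc.normc0.
by apply: le_trans (le_normcD _ _) _; apply: lerD.
Qed.

(** A supremum bounds only sets that are bounded above: the eigenvalues are the
    roots of the characteristic polynomial, and the sum of the moduli of these
    roots is a bound. *)
Lemma eigenvalue_lt1 n (M : 'M[R]_n) (l : R[i]) :
  spectral_radius M < 1 -> eigenvalue (map_mx toC M) l -> normc l < 1.
Proof.
move=> rho1 Ml; apply: le_lt_trans rho1.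
apply: ub_le_sup; last by exists l.
have [s sE] := closed_field_poly_normal (char_poly (map_mx toC M)).
rewrite (monicP (char_poly_monic _)) scale1r in sE.
exists (\sum_(z <- s) normc z) => _ [z /= Mz <-].
move: Mz; rewrite eigenvalue_root_char sE root_prod_XsubC => zs.
rewrite (big_rem z)//= lerDl sumr_ge0// => y _; exact: normc_ge0.
Qed.

(** The linear factors of the characteristic polynomial are peeled off one by
    one, each at the cost of one scalar contraction; no power of [M] is ever
    estimated. *)
Lemma stable_recurrence n (M : 'M[R]_n) (y g : nat -> 'cV[R]_n) :
  spectral_radius M < 1 -> (forall k, y k.+1 = M *m y k + g k) ->
  vanishes_exponentially g -> vanishes_exponentially y.
Proof.
(* Polynomials in M require square matrices of positive size. *)
case: n M y g => [|n] M y g rho1 rec /vanishes_exponentiallyP gv.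
  by apply/vanishes_exponentiallyP => -[].
pose Mc := map_mx toC M.
pose z (Q : {poly R[i]}) k := horner_mx Mc Q *m map_mx toC (y k).
pose h (Q : {poly R[i]}) k := horner_mx Mc Q *m map_mx toC (g k).
have h_decays Q i : decays (fun k => normc (h Q k i 0)).
  have H l : decays (fun k => normc (horner_mx Mc Q i l) * `|g k l 0|).
    by apply: decaysZ => //; apply: normc_ge0.
  apply: decays_le (decays_sum H) => k; rewrite mxE.
  apply: le_trans (normc_sum _) _.
  by under eq_bigr do rewrite ComplexField.Normc.normcM mxE normc_real.
have zS Q l k : z Q k.+1 = l *: z Q k + z (Q * ('X - l%:P)) k + h Q k.
  rewrite /z /h rec map_mxD map_mxM mulmxDr; congr (_ + _).
  rewrite scalemxAl -mulmxDl mulmxA; congr (_ *m _).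
  rewrite rmorphM rmorphB/= horner_mx_X horner_mx_C mulrBr addrC.
  by rewrite -[_ * l%:M]/(_ *m l%:M) mul_mx_scalar subrK.
(* Entrywise, the previous identity is a scalar contraction by l. *)
have step Q l : normc l < 1 ->
    (forall i, decays (fun k => normc (z (Q * ('X - l%:P)) k i 0))) ->
    forall i, decays (fun k => normc (z Q k i 0)).
  move=> l1 H i.
  apply: (decays_rec (normc_ge0 l) l1 _ (decaysD (H i) (h_decays Q i))).
  move=> k; rewrite (zS Q l) !mxE -ComplexField.Normc.normcM addrA.
  by apply: le_trans (le_normcD _ _) _; rewrite lerD2r le_normcD.
have [s sE] := closed_field_poly_normal (char_poly Mc).
rewrite (monicP (char_poly_monic _)) scale1r in sE.
have s1 l : l \in s -> normc l < 1.
  move=> ls; apply: (eigenvalue_lt1 rho1).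
  by rewrite eigenvalue_root_char -/Mc sE root_prod_XsubC.
have main t : {subset t <= s} -> forall Q,
    (forall i, decays (fun k => normc (z (Q * \prod_(l <- t) ('X - l%:P)) k i 0))) ->
    forall i, decays (fun k => normc (z Q k i 0)).
  elim: t => [|l t IH] ts Q; first by rewrite big_nil mulr1.
  rewrite big_cons mulrA => H; apply: (step Q l).
    by apply/s1/ts; rewrite mem_head.
  by apply: IH => // x xt; apply: ts; rewrite inE xt orbT.
apply/vanishes_exponentiallyP => i.
apply: (@decays_le _ _ (fun k => normc (z 1 k i 0))).
  by move=> k; rewrite /z rmorph1 mul1mx mxE normc_real.
apply: (main s) => // j; apply: decays_le decays0 => k.
by rewrite mul1r -sE /z Cayley_Hamilton mul0mx mxE ComplexField.Normc.normc0.
Qed.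

(** A vector fixed by [M] is a constant solution of the recurrence, hence it
    vanishes. *)
Lemma unitmx_1_sub n (M : 'M[R]_n) :
  spectral_radius M < 1 -> 1%:M - M \in unitmx.
Proof.
(* Kernels are row kernels here, hence the transposition. *)
move=> rho1; rewrite -unitmx_tr -row_free_unit -kermx_eq0.
apply/eqP/row_matrixP => i; rewrite row0; set v := row i _.
have : v *m (1%:M - M)^T = 0 by rewrite -row_mul mulmx_ker row0.
move/(congr1 trmx); rewrite trmx_mul trmxK trmx0 mulmxBl mul1mx => /subr0_eq vM.
apply: trmx_inj; rewrite trmx0; apply: vanishes_cst.
apply: (stable_recurrence rho1 _ (vanishes0 n)) => k.
by rewrite addr0.
Qed.

(** * Linear recurrences with periodic coefficients *)

Section periodic.
Variables (n N : nat) (M : nat -> 'M[R]_n).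
Hypotheses (N0 : (0 < N)%N) (perM : periodic_seq N M).

Lemma period_productS j : period_product M j.+1 = M j *m period_product M j.
Proof.
by rewrite /period_product big_ord_recl /= subn1.
Qed.

Lemma periodic_mul (U : Type) (u : nat -> U) q j :
  periodic_seq N u -> u (q * N + j)%N = u j.
Proof.
by move=> pu; elim: q => // q IH; rewrite mulSn -addnA addnC pu IH.
Qed.

(** Variation of constants over one block: [y (q * N + j)] is the product of the
    first [j] coefficients applied to [y (q * N)], plus a term that vanishes in
    [q].  For [j = N] this is a recurrence with constant coefficient for the
    samples [y (q * N)]. *)
Lemma stable_periodic (y f : nat -> 'cV[R]_n) :
  spectral_radius (period_product M N) < 1 ->
  (forall k, y k.+1 = M k *m y k + f k) ->
  vanishes_exponentially f -> vanishes_exponentially y.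
Proof.
move=> rho1 rec fv.
have block j : exists2 g : nat -> 'cV[R]_n, vanishes_exponentially g &
    forall q, y (q * N + j)%N = period_product M j *m y (q * N)%N + g q.
  elim: j => [|j [g gv IH]].
    exists (fun=> 0) => [|q]; first exact: vanishes0.
    by rewrite addn0 addr0 /period_product big_ord0 mul1mx.
  exists (fun q => M j *m g q + f (q * N + j)%N) => [|q].
    apply: vanishesD; first exact: vanishes_mulmx.
    exact: (decays_subseq j N0 fv).
  by rewrite addnS rec IH periodic_mul// mulmxDr mulmxA -period_productS addrA.
have yN : vanishes_exponentially (fun q => y (q * N)%N).
  have [g gv H] := block N.
  by apply: (stable_recurrence rho1 _ gv) => q; rewrite mulSn addnC H.
apply: (decays_merge N0) => j _; have [g gv H] := block j.
have : vanishes_exponentially (fun q => y (q * N + j)%N).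
  rewrite (_ : (fun _ => _) = fun q => period_product M j *m y (q * N)%N + g q).
    by apply: vanishesD => //; apply: vanishes_mulmx.
  by apply/funext.
by [].
Qed.

(** The solution started at [v] is periodic as soon as it returns to [v] after
    one period, which is a linear equation for [v]. *)
Lemma periodic_solution (b : nat -> 'cV[R]_n) :
  spectral_radius (period_product M N) < 1 -> periodic_seq N b ->
  exists2 s, periodic_seq N s & forall k, s k.+1 = M k *m s k + b k.
Proof.
move=> rho1 pb.
pose sol v := fix s k : 'cV[R]_n := if k is k'.+1 then M k' *m s k' + b k' else v.
have solE v k : sol v k = period_product M k *m v + sol 0 k.
  elim: k => [|k IH] /=; first by rewrite /period_product big_ord0 mul1mx addr0.
  by rewrite IH mulmxDr mulmxA -period_productS addrA.
pose v := invmx (1%:M - period_product M N) *m sol 0 N.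
have vN : sol v N = v.
  rewrite solE; apply/eqP; rewrite eq_sym addrC -subr_eq -[X in X - _]mul1mx -mulmxBl.
  by rewrite /v mulmxA mulmxV ?mul1mx// unitmx_1_sub.
exists (sol v) => // k; elim: k => [|k IH]; first by rewrite add0n vN.
by rewrite addSn /= IH perM pb.
Qed.

Lemma periodic_vanishing (s : nat -> 'cV[R]_n) :
  periodic_seq N s -> vanishes_exponentially s -> forall k, s k = 0.
Proof.
move=> ps sv k; apply: vanishes_cst.
have := decays_subseq k N0 sv.
by under eq_fun do rewrite periodic_mul//.
Qed.

End periodic.
End spectral.

(** * Means of affine images of integrable random vectors *)

Section moments.
Context {d : measure_display} {T : measurableType d} {R : realType}.
Variable P : probability T R.

Lemma meanE n (X : T -> 'cV[R]_n) i :
  mean P X i 0 = (\int[P]_t X t i 0)%R.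
Proof. by rewrite mxE unlock. Qed.

Lemma integrable_vectorD n (X Y : T -> 'cV[R]_n) :
  integrable_vector P X -> integrable_vector P Y ->
  integrable_vector P (fun t => X t + Y t).
Proof.
move=> iX iY i; under eq_fun do rewrite mxE EFinD.
exact: integrableD.
Qed.

Lemma mean_add n (X Y : T -> 'cV[R]_n) :
  integrable_vector P X -> integrable_vector P Y ->
  mean P (fun t => X t + Y t) = mean P X + mean P Y.
Proof.
move=> iX iY; apply/colP => i; rewrite [RHS]mxE !meanE.
rewrite -RintegralD//; [|exact: iX|exact: iY].
by apply: eq_Rintegral => t _; rewrite mxE.
Qed.

Lemma integrable_vector_mulmx n m (M : 'M[R]_(m, n)) (X : T -> 'cV[R]_n) :
  integrable_vector P X -> integrable_vector P (fun t => M *m X t).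
Proof.
move=> iX i; under eq_fun do rewrite mxE -sumEFin.
apply: integrable_sum => // j _; under eq_fun do rewrite EFinM.
exact: integrableZl.
Qed.

Lemma mean_mulmx n m (M : 'M[R]_(m, n)) (X : T -> 'cV[R]_n) :
  integrable_vector P X -> mean P (fun t => M *m X t) = M *m mean P X.
Proof.
move=> iX; apply/colP => i; rewrite meanE [RHS]mxE.
have iMX j : P.-integrable [set: T] (fun t => (M i j * X t j 0)%:E).
  by under eq_fun do rewrite EFinM; apply: integrableZl.
rewrite /Rintegral; under eq_integral do rewrite mxE -sumEFin.
rewrite integral_sum// -sum_fine => [|j _]; last exact: integrable_fin_num.
apply: eq_bigr => j _; rewrite meanE -RintegralZl//.
exact: iX.
Qed.

Lemma integrable_vector_cst n (v : 'cV[R]_n) : integrable_vector P (fun=> v).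
Proof. by move=> i; apply: finite_measure_integrable_cst. Qed.

Lemma mean_cst n (v : 'cV[R]_n) : mean P (fun=> v) = v.
Proof. by apply/colP => i; rewrite mxE expectation_cst. Qed.

End moments.

(** * Convergence of the mean state and of the mean estimation error *)

Theorem proposition1 (R : realType) (d : measure_display)
    (T : measurableType d) (P : probability T R) (n m p N : nat)
    (A : 'M[R]_n) (B : 'M[R]_(n, m)) (C : 'M[R]_(p, n))
    (K : 'M[R]_(m, n)) (L : 'M[R]_(n, p)) (uT : 'cV[R]_m)
    (eta : nat -> bool)
    (x e w : nat -> T -> 'cV[R]_n) (nu : nat -> T -> 'cV[R]_p)
    (Sigma_w : 'M[R]_n) (Sigma_nu : 'M[R]_p) (qA qtA : R)
    (N_gt0 : (0 < N)%N)
    (eta_periodic : periodic_seq N eta)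
    (x_rec : forall k t,
      x k.+1 t = Abar A B K eta k *m x k t
                 - (eta k)%:R *: (B *m K *m e k t)
                 + (eta k)%:R *: (B *m uT) + w k t)
    (e_rec : forall k t,
      e k.+1 t = Atilde A L C eta k *m e k t + w k t
                 + (1 - (eta k)%:R) *: (L *m nu k t))
    (noise_iid : iid_mutually_independent P w nu)
    (w_mean : forall k, integrable_vector P (w k) /\ mean P (w k) = 0)
    (nu_mean : forall k, integrable_vector P (nu k) /\ mean P (nu k) = 0)
    (w_cov : forall k, has_second_moment P (w k) Sigma_w)
    (nu_cov : forall k, has_second_moment P (nu k) Sigma_nu)
    (x0_rv : random_vector (x 0%N)) (x0_mean : integrable_vector P (x 0%N))
    (e0_rv : random_vector (e 0%N)) (e0_mean : integrable_vector P (e 0%N))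
    (rho_A : spectral_radius (period_product (Abar A B K eta) N) = qA)
    (qA_lt1 : qA < 1)
    (rho_tA : spectral_radius (period_product (Atilde A L C eta) N) = qtA)
    (qtA_lt1 : qtA < 1) :
  let mu_x := fun k => mean P (x k) in
  let mu_e := fun k => mean P (e k) in
  (forall k, integrable_vector P (x k) /\ integrable_vector P (e k)) /\
  (forall k, mu_x k.+1 = Abar A B K eta k *m mu_x k
                         - (eta k)%:R *: (B *m K *m mu_e k)
                         + (eta k)%:R *: (B *m uT)) /\
  (forall k, mu_e k.+1 = Atilde A L C eta k *m mu_e k) /\
  vanishes_exponentially mu_e /\
  exists mu_s : nat -> 'cV[R]_n,
    [/\ periodic_mean_solution A B K uT eta N mu_s,
        (forall s, periodic_mean_solution A B K uT eta N s -> s =1 mu_s),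
        vanishes_exponentially (fun k => mu_x k - mu_s k) &
        uT = 0 -> forall k, mu_s k = 0].
Proof.
move=> mu_x mu_e.
have iw k := (w_mean k).1; have inu k := (nu_mean k).1.
have eE k : e k.+1 = fun t => (Atilde A L C eta k *m e k t + w k t)
    + ((1 - (eta k)%:R) *: L) *m nu k t.
  by apply/funext => t; rewrite e_rec -scalemxAl.
have xE k : x k.+1 = fun t => ((Abar A B K eta k *m x k t
    + (- (eta k)%:R *: (B *m K)) *m e k t) + (eta k)%:R *: (B *m uT)) + w k t.
  by apply/funext => t; rewrite x_rec -[in RHS]scalemxAl scaleNr.
have ie k : integrable_vector P (e k).
  elim: k => [//|k IH]; rewrite eE.
  by do !apply: integrable_vectorD => //; apply: integrable_vector_mulmx.
have ix k : integrable_vector P (x k).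
  elim: k => [//|k IH]; rewrite xE; do !apply: integrable_vectorD => //;
    by [exact: integrable_vector_mulmx | exact: integrable_vector_cst].
have mu_eE k : mu_e k.+1 = Atilde A L C eta k *m mu_e k.
  rewrite /mu_e eE !mean_add ?mean_mulmx ?(w_mean k).2 ?(nu_mean k).2//;
    do ?[apply: integrable_vectorD | exact: integrable_vector_mulmx] => //.
  by rewrite mulmx0 !addr0.
have mu_xE k : mu_x k.+1 = Abar A B K eta k *m mu_x k
    - (eta k)%:R *: (B *m K *m mu_e k) + (eta k)%:R *: (B *m uT).
  rewrite /mu_x xE !mean_add ?mean_mulmx ?mean_cst ?(w_mean k).2//;
    do ?[apply: integrable_vectorD | exact: integrable_vector_mulmx
        | exact: integrable_vector_cst] => //.
  by rewrite addr0 -scalemxAl scaleNr.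
have perA : periodic_seq N (Abar A B K eta).
  by move=> k; rewrite /Abar eta_periodic.
have perAt : periodic_seq N (Atilde A L C eta).
  by move=> k; rewrite /Atilde eta_periodic.
rewrite -rho_A in qA_lt1; rewrite -rho_tA in qtA_lt1.
have mu_e0 : vanishes_exponentially mu_e.
  apply: (stable_periodic N_gt0 perAt qtA_lt1 _ (vanishes0 n)) => k.
  by rewrite mu_eE addr0.
have [s pers solS] : exists2 s, periodic_seq N s & forall k,
    s k.+1 = Abar A B K eta k *m s k + (eta k)%:R *: (B *m uT).
  by apply: periodic_solution => // k; rewrite eta_periodic.
(* A difference of two solutions is periodic and solves the unforced recurrence. *)
have uniq_s s' : periodic_mean_solution A B K uT eta N s' -> s' =1 s.
  move=> [pers' sol'] k; apply/subr0_eq; move: k.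
  apply: (periodic_vanishing N_gt0) => [k|]; first by rewrite pers pers'.
  apply: (stable_periodic N_gt0 perA qA_lt1 _ (vanishes0 n)) => k.
  by rewrite sol' solS mulmxBr opprD addrACA subrr.
do !split=> //; exists s; split=> //.
- apply: (stable_periodic N_gt0 perA qA_lt1
    (f := fun k => (eta k)%:R *: ((- (B *m K)) *m mu_e k))) => [k|].
    rewrite mu_xE solS mulmxBr mulNmx scalerN opprD.
    by rewrite addrACA subrr addr0 addrAC.
  exact/vanishes_indicator/vanishes_mulmx.
- move=> uT0 k; rewrite -(uniq_s (fun=> 0))//; split=> // j.
  by rewrite uT0 !mulmx0 scaler0 addr0.
Qed.
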